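(* Let $p$ be a prime, let $g$ be a primitive root modulo $p$, and let $N<p^{1/2}$ be a positive integer. Then $$\frac{1}{p}\sum_{x=0}^{p-1}\left|\sum_{n\le N}e^{2\pi i\frac{x}{p}g^n}\right|\gg N^{1/48+o(1)},$$ where $o(1)$ denotes a quantity tending to $0$ as $N\to\infty$. *)

(* Defs.v *)
From Stdlib Require Import Reals ZArith Znumtheory Arith.
Open Scope R_scope.

Fixpoint sum0 (f : nat -> R) (n : nat) : R :=
  match n with
  | O => 0
  | S m => sum0 f m + f m
  end.

Definition primitive_root (p g : nat) : Prop :=
  Nat.modulo (Nat.pow g (p - 1)) p = 1%nat /\
  forall k : nat, (0 < k < p - 1)%nat -> Nat.modulo (Nat.pow g k) p <> 1%nat.

(* Complex modulus of sum_{n=1}^N e(x g^n / p), e(t) = exp(2 pi i t),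
   written out via real and imaginary parts. *)
Definition exp_sum_abs (p g N x : nat) : R :=
  let t := fun n : nat => 2 * PI * (INR x * (INR g) ^ (S n) / INR p) in
  sqrt ((sum0 (fun n => cos (t n)) N) ^ 2 + (sum0 (fun n => sin (t n)) N) ^ 2).

Definition avg_abs_sum (p g N : nat) : R :=
  / INR p * sum0 (fun x => exp_sum_abs p g N x) p.

(* Main.v *)
(** Let S(x) be the exponential sum and E the number of solutions of
    g^i + g^j = g^k + g^l with exponents in [1, N].  The mean of |S|^2 is at least N and
    the mean of |S|^4 is E, so by Hoelder N^3 <= A^2 E for the mean A of |S|, and a power
    saving in E suffices.  Dividing by one of the powers, E is at most N^2 + 3 N^2 J,
    where J bounds the size of the sets X of x = 1 + th y with x and y in {g^a : |a| <= N}.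

    Ratios of elements of X take only O(N) values, so most pairs (c, e) of X have many
    solutions of c x' = e x in X, and each of them rewrites c - e as a difference of two
    elements of th {g^a : |a| <= 2N}.  Let X' be a suitable subset of X and R the set of
    the quotients (a - b) / (c - d) of its nonzero differences.  If r is in R and
    v1 + mu r v2 takes distinct values on almost all pairs (v1, v2) of X', where mu is a
    ratio of two values of y, then (c - d) v1 + mu (a - b) v2 can be expanded as a sum of
    ten terms from a set of size O(N) in too many ways, unless X is small.  If mu r is
    outside R the values are all distinct; so R is stable under most mu, hence under some
    g^t with t = O(N / |X|).  As g is a primitive root, R is then so large that, because
    of N^2 < p, one of its elements has almost no collisions, and the same expansion
    applies to it.  This gives J = O(N^(1 - 1/22)) and the exponent 1/44. *)
From mathcomp Require Import ssreflect.
From mathcomp Require all_boot all_order all_algebra finfield ring lra zify Rstruct complex.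
Require Import Defs.
From Stdlib Require Import Reals ZArith Znumtheory Arith Lra.

Module GeometricSums.

Import all_boot all_order all_algebra finfield.
Import Rstruct complex ring lra zify.
Import GRing.Theory.
Set Implicit Arguments.
Unset Strict Implicit.
Unset Printing Implicit Defensive.
Local Open Scope nat_scope.

(** * Counting in finite sets *)

Section Counting.
Variables T T' : finType.

Lemma exists_le_average (A : {set T}) (f : T -> nat) : 0 < #|A| ->
  exists2 a, a \in A & #|A| * f a <= \sum_(b in A) f b.
Proof.
move=> /card_gt0P[a0 a0A]; case: (arg_minnP f a0A) => a aA fa_min.
by exists a => //; rewrite -sum_nat_const; apply: leq_sum.
Qed.

Lemma exists_ge_average (A : {set T}) (f : T -> nat) : 0 < #|A| ->
  exists2 a, a \in A & \sum_(b in A) f b <= #|A| * f a.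
Proof.
move=> /card_gt0P[a0 a0A]; case: (arg_maxnP f a0A) => a aA fa_max.
by exists a => //; rewrite -sum_nat_const; apply: leq_sum.
Qed.

Lemma markov_card (A : {set T}) (f : T -> nat) e :
  e * #|[set a in A | e <= f a]| <= \sum_(a in A) f a.
Proof.
rewrite mulnC -sum_nat_const [leqRHS](big_setID [set a in A | e <= f a]) /=.
rewrite (setIidPr _); last by apply/subsetP => a; rewrite inE => /andP[].
by apply: leq_trans (leq_addr _ _); apply: leq_sum => a; rewrite inE => /andP[].
Qed.

Lemma sum_card_exchange (A : {set T}) (B : {set T'}) (P : T -> T' -> bool) :
  \sum_(a in A) #|[set b in B | P a b]| = \sum_(b in B) #|[set a in A | P a b]|.
Proof.
under eq_bigr do rewrite -sum1dep_card big_mkcondr.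
rewrite exchange_big; apply: eq_bigr => b _.
by rewrite -big_mkcondr sum1dep_card.
Qed.

Definition sigma_set (A : {set T}) (B : T -> {set T'}) : {set T * T'} :=
  [set z | (z.1 \in A) && (z.2 \in B z.1)].

Lemma card_sigma_set (A : {set T}) (B : T -> {set T'}) : #|sigma_set A B| = \sum_(a in A) #|B a|.
Proof.
rewrite -sum1_card; under [RHS]eq_bigr do rewrite -sum1_card.
by rewrite pair_big_dep /=; apply: eq_bigl => z; rewrite inE.
Qed.

Lemma leq_card_sigma_set (A : {set T}) (B : T -> {set T'}) k :
  (forall a, a \in A -> k <= #|B a|) -> #|A| * k <= #|sigma_set A B|.
Proof. by move=> kB; rewrite card_sigma_set -sum_nat_const; apply: leq_sum. Qed.

Lemma card_sigma_set_leq (A : {set T}) (B : T -> {set T'}) k :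
  (forall a, a \in A -> #|B a| <= k) -> #|sigma_set A B| <= #|A| * k.
Proof. by move=> Bk; rewrite card_sigma_set -sum_nat_const; apply: leq_sum. Qed.

Lemma exists_large_fiber (A : {set T}) (D : {set T * T'}) :
  0 < #|A| -> {in D, forall z, z.1 \in A} ->
  exists2 a, a \in A & #|D| <= #|A| * #|[set b | (a, b) \in D]|.
Proof.
move=> A_gt0 DA.
have -> : #|D| = \sum_(a in A) #|[set b | (a, b) \in D]|.
  rewrite -card_sigma_set; apply: eq_card => -[a b]; rewrite !inE /=.
  by case abD: (_ \in D); rewrite ?andbF // (DA _ abD).
exact: exists_ge_average.
Qed.

Lemma card_small_fibers (A : {set T}) (f : T -> T') (R : {set T'}) t :
  {in A, forall a, f a \in R} ->
  #|[set a in A | #|[set b in A | f b == f a]| < t]| <= #|R| * t.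
Proof.
move=> fAR; set S := [set a in A | _].
rewrite -sum1_card (partition_big f (mem R)) /=; last first.
  by move=> a; rewrite inE => /andP[/fAR].
rewrite -sum_nat_const; apply: leq_sum => r _; rewrite sum1dep_card.
have [->|[a]] := set_0Vmem [set a in S | f a == r]; first by rewrite cards0.
rewrite !inE => /andP[/andP[aA small] /eqP <-]; apply: leq_trans (ltnW small).
by apply: subset_leq_card; apply/subsetP => b; rewrite !inE => /andP[/andP[-> _] ->].
Qed.

Lemma exists_subset_card (A : {set T}) k : k <= #|A| ->
  exists2 B : {set T}, B \subset A & #|B| = k.
Proof.
rewrite -bin_gt0 -cards_draws => /card_gt0P[B]; rewrite inE => /andP[BA /eqP].
by exists B.
Qed.

End Counting.

Section SparseRelations.
Variables (T : finType) (P : rel T).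
Hypothesis P_irr : irreflexive P.
Implicit Types X Z : {set T}.

Definition edges Z : {set T * T} := [set w in setX Z Z | P w.1 w.2].

Lemma card_edges Z : #|edges Z| = \sum_(a in Z) #|[set b in Z | P a b]|.
Proof. by rewrite -card_sigma_set; apply: eq_card => w; rewrite !inE andbA. Qed.

Lemma sum_card_edges_setD1 Z :
  \sum_(z in Z) #|edges (Z :\ z)| = #|edges Z| * (#|Z| - 2).
Proof.
have edges_setD1 z : edges (Z :\ z) = [set w in edges Z | z \notin [set w.1; w.2]].
  apply/setP => w; rewrite !inE negb_or ![_ == z]eq_sym.
  by rewrite andbACA [RHS]andbC [RHS]andbA.
under eq_bigr do rewrite edges_setD1.
rewrite sum_card_exchange -sum_nat_const; apply: eq_bigr => -[a b].
rewrite !inE /= => /andP[/andP[aZ bZ] Pab].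
have ab : a != b by apply: contraTneq Pab => ->; rewrite P_irr.
have <- : #|[set a; b]| = 2 by rewrite cards2 ab.
have -> : [set z in Z | z \notin [set a; b]] = Z :\: [set a; b].
  by apply/setP => z; rewrite !inE andbC.
by rewrite cardsD (setIidPr _) //; apply/subsetP => z; rewrite !inE => /orP[]/eqP->.
Qed.

Lemma edge_density_setD1 Z : 0 < #|Z| ->
  exists2 z, z \in Z & #|edges (Z :\ z)| * #|Z| ^ 2 <= #|edges Z| * #|Z|.-1 ^ 2.
Proof.
move=> Z_gt0; have [z zZ] := exists_le_average (fun z => #|edges (Z :\ z)|) Z_gt0.
rewrite sum_card_edges_setD1 => le_avg; exists z => //.
apply: (@leq_trans (#|edges Z| * (#|Z| - 2) * #|Z|)); first by nia.
by rewrite -mulnA leq_mul2l; apply/orP; right; nia.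
Qed.

Lemma edge_density_subset X m : m <= #|X| ->
  exists Z, [/\ Z \subset X, #|Z| = m & #|edges Z| * #|X| ^ 2 <= #|edges X| * m ^ 2].
Proof.
move=> /subnKC/esym; move: (_ - _) => k; elim: k m => [|k IH] m cX.
  by exists X; rewrite cX addn0; split.
have [|Z [ZX cZ Z_sparse]] := IH m.+1; first by rewrite cX addSnnS.
have [|z zZ] := @edge_density_setD1 Z; first by rewrite cZ.
rewrite cZ /= => Zz_sparse; exists (Z :\ z); split.
- exact: subset_trans (subD1set _ _) ZX.
- by have := cardsD1 z Z; rewrite zZ cZ => -[].
- rewrite -(@leq_pmul2r (m.+1 ^ 2)) ?expn_gt0 // mulnAC.
  apply: leq_trans (leq_mul Zz_sparse (leqnn _)) _.
  by rewrite mulnAC [leqRHS]mulnAC leq_mul.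
Qed.

Lemma sparse_regular_subset X m r :
  0 < r -> m <= #|X| -> r ^ 2 * #|edges X| <= #|X| ^ 2 ->
  exists Z, [/\ Z \subset X, #|Z| <= m, r.-1 * m <= r * #|Z| &
    {in Z, forall c, r * #|[set e in Z | P c e]| <= m}].
Proof.
move=> r_gt0 mX X_sparse; have [Z [ZX cZ Z_sparse]] := edge_density_subset mX.
have {X_sparse}Z_sparse : r ^ 2 * #|edges Z| <= m ^ 2.
  have [X0|X_gt0] := posnP #|X|.
    have Z0 : Z = set0 by apply/eqP; rewrite -cards_eq0 cZ -leqn0 -X0.
    by rewrite card_edges Z0 big_set0 muln0.
  rewrite -(@leq_pmul2r (#|X| ^ 2)) ?expn_gt0 ?X_gt0 //; nia.
pose deg c := #|[set e in Z | P c e]|; pose Y := [set c in Z | r * deg c <= m].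
have YZ : Y \subset Z by apply/subsetP => c; rewrite inE => /andP[].
exists Y; split; first exact: subset_trans ZX.
- by rewrite -cZ subset_leq_card.
- have cY : #|Y| + #|[set c in Z | (m %/ r).+1 <= deg c]| = m.
    rewrite -[RHS]cZ -(cardsID Y Z) (setIidPr YZ); congr (_ + _).
    apply: eq_card => c; rewrite !inE; case: (c \in Z) => //=.
    by rewrite andbT -ltnNge ltn_divLR // mulnC.
  have := markov_card Z deg (m %/ r).+1; rewrite -card_edges.
  have : m < r * (m %/ r).+1 by rewrite mulnC ltn_ceil.
  by move: cY Z_sparse r_gt0; case: (r) => // r' /=; nia.
- move=> c; rewrite inE => /andP[cZ' deg_le]; apply: leq_trans deg_le.
  rewrite leq_mul2l subset_leq_card ?orbT //.
  by apply/subsetP => e; rewrite !inE => /andP[/andP[-> _] ->].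
Qed.

End SparseRelations.

(** * Geometric progressions and additive energy *)

Section Windows.
Variables (F : finFieldType) (g : F) (N : nat).
Hypothesis g_neq0 : g != 0%R.

(* The powers g^a with |a| <= k N. *)
Definition window k : {set F} :=
  [set (g ^+ a / g ^+ (k * N))%R | a : 'I_(2 * k * N).+1].

Lemma windowP k z :
  reflect (exists2 a, a <= 2 * k * N & z = (g ^+ a / g ^+ (k * N))%R) (z \in window k).
Proof.
apply: (iffP imsetP) => [[a _ ->]|[a]]; first by exists a; rewrite // -ltnS.
by rewrite -ltnS => lt_a ->; exists (Ordinal lt_a).
Qed.

Lemma card_window k : #|window k| <= 2 * k * N + 1.
Proof. by apply: leq_trans (leq_imset_card _ _) _; rewrite card_ord addn1. Qed.

Lemma window_neq0 k z : z \in window k -> z != 0%R.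
Proof. by case/windowP=> a _ ->; rewrite mulf_neq0 ?invr_neq0 ?expf_neq0. Qed.

Lemma windowM i j z w : z \in window i -> w \in window j -> (z * w)%R \in window (i + j).
Proof.
move=> /windowP[a le_a ->] /windowP[b le_b ->]; apply/windowP; exists (a + b).
  by rewrite mulnDr mulnDl leq_add.
by rewrite mulnDl !exprD invfM mulrACA.
Qed.

Lemma expg_div_window k a b : a <= b + k * N -> b <= a + k * N ->
  (g ^+ a / g ^+ b)%R \in window k.
Proof.
move=> le_a le_b; apply/windowP; exists (a + k * N - b); first by lia.
by apply/eqP; rewrite eqr_div ?expf_neq0 // -!exprD subnK.
Qed.

Lemma windowV k z : z \in window k -> (z^-1)%R \in window k.
Proof. by case/windowP=> a le_a ->; rewrite invf_div expg_div_window //; lia. Qed.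

Lemma window_div i j z w : z \in window i -> w \in window j -> (z / w)%R \in window (i + j).
Proof. by move=> zi wj; rewrite windowM ?windowV. Qed.

Lemma window_leq i j : i <= j -> window i \subset window j.
Proof.
move=> le_ij; apply/subsetP=> _ /windowP[a le_a ->]; apply: expg_div_window; nia.
Qed.

Lemma window_close_pair k d (A : {set F}) :
  0 < d -> A \subset window k -> (2 * k * N %/ d).+1 < #|A| ->
  exists z w t, [/\ z \in A, w \in A, 0 < t < d & w = (g ^+ t * z)%R].
Proof.
move=> d_gt0 AW cA; pose power a := (g ^+ a / g ^+ (k * N))%R.
pose E := [set a : 'I_(2 * k * N).+1 | power a \in A].
have AE : A \subset [set power a | a : 'I__ in E].
  apply/subsetP=> z zA; have /imsetP[a _ def_z] := subsetP AW z zA.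
  by apply/imsetP; exists a; rewrite // inE /power -def_z.
have block_lt (a : 'I_(2 * k * N).+1) : a %/ d < (2 * k * N %/ d).+1.
  by rewrite ltnS leq_div2r // -ltnS.
have /dinjectivePn[a aE [b /andP[ab bE] eq_block]] :
    ~~ dinjectiveb (fun a => Ordinal (block_lt a)) (mem E).
  apply/negP=> /dinjectiveP/card_in_imset cE; move: cA; rewrite ltnNge => /negP; apply.
  apply: leq_trans (subset_leq_card AE) _; apply: leq_trans (leq_imset_card _ _) _.
  by rewrite -cE -[leqRHS]card_ord max_card.
have {eq_block}/(congr1 val)/= eq_block := eq_block.
wlog lt_ab : a b aE bE ab eq_block / a < b.
  move=> wlog_ab; have [lt|gt|/val_inj eq_ab] := ltngtP a b; first exact: wlog_ab lt.
    by apply: (wlog_ab b a); rewrite // eq_sym.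
  by rewrite eq_ab eqxx in ab.
exists (power a), (power b), (b - a); split; rewrite ?inE in aE bE *; rewrite ?aE ?bE //.
  have := divn_eq a d; have := divn_eq b d; rewrite eq_block.
  by have := ltn_pmod b d_gt0; have := ltn_pmod a d_gt0; lia.
by rewrite /power mulrA -exprD subnK // ltnW.
Qed.

End Windows.

Section Ordinate.
Variables (F : fieldType) (th : F).

Definition ordinate (x : F) : F := ((x - 1) / th)%R.

Hypothesis th_neq0 : th != 0%R.

Lemma ordinateK x : (1 + th * ordinate x)%R = x.
Proof. by rewrite mulrC divfK // addrC subrK. Qed.

Lemma ordinate_inj : injective ordinate.
Proof. by move=> x y /(congr1 (fun u => 1 + th * u)%R); rewrite !ordinateK. Qed.

End Ordinate.

(* The points (x, y) of W x W on the line x = 1 + th y, recorded by x. *)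
Definition line_points (F : finFieldType) (W : {set F}) (th : F) : {set F} :=
  [set x in W | ordinate th x \in W].

Section AdditiveEnergy.
Variable I : finType.

Definition energy_set (V : nmodType) (a : I -> V) : {set (I * I) * (I * I)} :=
  [set q | a q.1.1 + a q.1.2 == a q.2.1 + a q.2.2]%R.

Definition energy (V : nmodType) (a : I -> V) : nat := #|energy_set a|.

Definition modular_energy (p : nat) (a : I -> nat) : nat :=
  #|[set q : (I * I) * (I * I) | a q.1.1 + a q.1.2 == a q.2.1 + a q.2.2 %[mod p]]|.

Variables (F : finFieldType) (a : I -> F).
Hypothesis a_inj : injective a.

Definition degenerate : {set (I * I) * (I * I)} := [set q | q.1.2 == q.2.2].

Lemma card_degenerate_energy : #|energy_set a :&: degenerate| <= #|I| ^ 2.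
Proof.
rewrite -mulnn -card_prod -(@card_in_imset _ _ fst); first exact: max_card.
move=> [[i j] [k l]] [[i' j'] [k' l']]; rewrite !inE /=.
move=> /andP[/eqP eq_sum /eqP jl] /andP[/eqP eq_sum' /eqP jl'] [ii' jj'].
by move: eq_sum; rewrite -jl -jl' ii' jj' eq_sum' -jl' => /addIr/a_inj->.
Qed.

Hypothesis a_neq0 : forall i, a i != 0%R.
Variables (W : {set F}) (J : nat).
Hypothesis div_aW : forall i j, (a i / a j)%R \in W.
Hypothesis line_pointsJ : forall th : F, th != 0%R -> #|line_points W th| <= J.

(* Dividing a i + a j = a k + a l by a k gives x = 1 + th y
   with x = a i / a k, y = a l / a k and th = 1 - a j / a l. *)
Lemma ordinate_of_energy i j k l :
  (a i + a j)%R = (a k + a l)%R -> j != l ->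
  ordinate (1 - a j / a l)%R (a i / a k)%R = (a l / a k)%R.
Proof.
move=> eq_sum jl; have alj : (a l - a j)%R != 0%R.
  by rewrite subr_eq0 (inj_eq a_inj) eq_sym.
have -> : a i = (a k + a l - a j)%R by rewrite -eq_sum addrK.
by rewrite /ordinate; field; rewrite !a_neq0.
Qed.

Lemma card_nondegenerate_energy : #|energy_set a :\: degenerate| <= #|I| * (#|W| * J).
Proof.
pose lines := sigma_set (W :\ 1%R) (fun t => line_points W (1 - t)%R).
have le_lines : #|lines| <= #|W| * J.
  apply: (@leq_trans (#|W :\ 1%R| * J)).
    apply: card_sigma_set_leq => t; rewrite in_setD1 => /andP[t1 _].
    by rewrite line_pointsJ // subr_eq0 eq_sym.
  by rewrite leq_mul2r subset_leq_card ?orbT ?subD1set.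
apply: leq_trans (_ : #|setX [set: I] lines| <= _); last first.
  by rewrite cardsX cardsT leq_mul2l le_lines orbT.
pose f (q : (I * I) * (I * I)) := (q.2.1, (a q.1.2 / a q.2.2, a q.1.1 / a q.2.1)%R).
rewrite -(@card_in_imset _ _ f); last first.
  move=> [[i j] [k l]] [[i' j'] [k' l']]; rewrite !inE /=.
  move=> /andP[jl /eqP/ordinate_of_energy/(_ jl) y_def].
  move=> /andP[jl' /eqP/ordinate_of_energy/(_ jl') y_def'] [kk' eq_th eq_x].
  rewrite -kk' in eq_x y_def'.
  have div_inj m : injective (fun i => a i / a m)%R.
    by move=> u v /(mulIf (invr_neq0 (a_neq0 m)))/a_inj.
  have ll' : l = l' by apply: (div_inj k); rewrite /= -y_def -y_def' eq_th eq_x.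
  by rewrite -ll' in eq_th *; rewrite (div_inj _ _ _ eq_th) (div_inj _ _ _ eq_x) kk'.
apply: subset_leq_card; apply/subsetP => _ /imsetP[[[i j] [k l]] + ->].
rewrite !inE /= !div_aW => /andP[jl /eqP/ordinate_of_energy->//].
by rewrite div_aW !andbT; apply: contraNneq jl => /divr1_eq/a_inj->.
Qed.

Lemma energy_le : energy a <= #|I| ^ 2 + #|I| * (#|W| * J).
Proof.
rewrite /energy -(cardsID degenerate).
exact: leq_add card_degenerate_energy card_nondegenerate_energy.
Qed.

End AdditiveEnergy.

(** * Expansions into ten terms *)

Section LegsAndBridges.
Local Open Scope ring_scope.
Variables (F : fieldType) (th : F).
Hypothesis th_neq0 : th != 0.
Local Notation y := (ordinate th).

(* If x and x' lie on the line x = 1 + th y and c x' = e x, then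
   c - e = th (e y(x) - c y(x')); a leg applies this to c -> e and to e -> d. *)
Definition leg (c d v : F) (l : F * F * F) : F * F * F :=
  let: (e, u, w) := l in (v * c * y (e / c * u), v * d * y (e / d * w), v * e * y w).

Definition leg_total (t : F * F * F) : F := t.1.1 - t.1.2 + t.2.

Lemma leg_totalE (c d v e u w : F) : c != 0 -> d != 0 ->
  th * (v * e * y u - leg_total (leg c d v (e, u, w))) = v * (c - d).
Proof.
by move=> c_neq0 d_neq0; rewrite /leg_total /leg /ordinate /=; field; rewrite th_neq0 d_neq0.
Qed.

Lemma leg_inj (c d v : F) : c != 0 -> d != 0 -> v != 0 ->
  {in [pred l | l.1.1 != 0] &, injective (leg c d v)}.
Proof.
move=> c_neq0 d_neq0 v_neq0 [[e u] w] [[e' u'] w']; rewrite !inE /=.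
move=> e_neq0 e'_neq0 [eq_c eq_d eq_e].
have unscale (k p q p' q' : F) : k != 0 ->
    v * k * y (p / k * q) = v * k * y (p' / k * q') -> p * q = p' * q'.
  move=> k_neq0 /(mulfI (mulf_neq0 v_neq0 k_neq0))/(ordinate_inj th_neq0).
  by rewrite ![_ / k * _]mulrAC => /(mulIf (invr_neq0 k_neq0)).
have {}eq_c := unscale _ _ _ _ _ c_neq0 eq_c.
have {}eq_d := unscale _ _ _ _ _ d_neq0 eq_d.
have ee' : e = e'.
  have affine (p q : F) : v * p = v * (p * q) - th * (v * p * y q).
    by rewrite /ordinate; field.
  by apply: (mulfI v_neq0); rewrite (affine e w) (affine e' w') eq_d eq_e.
by rewrite -ee' in eq_c eq_d *; rewrite (mulfI e_neq0 eq_c) (mulfI e_neq0 eq_d).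
Qed.

(* If T y(x) = T' y(x') then T - T' = T x - T' x'; a bridge goes from T1 to T2
   through T1 y(x1) / y(x2). *)
Definition bridge (T1 T2 : F) (x : F * F * (F * F)) : F * F * (F * F) :=
  let: (x1, x2, (x3, x4)) := x in
  let T := T1 * y x1 / y x2 in (T1 * x1, T * x2, (T * x3, T2 * x4)).

Definition bridge_total (t : F * F * (F * F)) : F := t.1.1 - t.1.2 + t.2.1 - t.2.2.

Lemma bridge_totalE (T1 T2 x1 x2 x3 x4 : F) : y x2 != 0 ->
  T1 * y x1 * y x3 = T2 * y x4 * y x2 ->
  bridge_total (bridge T1 T2 (x1, x2, (x3, x4))) = T1 - T2.
Proof.
move=> y2_neq0 balance; rewrite /bridge_total /=; set T := T1 * _ / _.
have T_x2 : T * y x2 = T1 * y x1 by rewrite mulfVK.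
have T_x3 : T * y x3 = T2 * y x4 by apply: (mulIf y2_neq0); rewrite mulrAC T_x2 balance.
have split_x (t x : F) : t * x = t + th * (t * y x) by rewrite /ordinate; field.
by rewrite (split_x T1 x1) (split_x T x2) (split_x T x3) (split_x T2 x4) T_x2 T_x3; ring.
Qed.

Lemma bridge_inj (T1 T2 : F) : T1 != 0 -> T2 != 0 ->
  {in [pred x | (y x.1.1 != 0) && (y x.1.2 != 0)] &, injective (bridge T1 T2)}.
Proof.
move=> T1_neq0 T2_neq0 [[x1 x2] [x3 x4]] [[z1 z2] [z3 z4]]; rewrite !inE /=.
move=> /andP[yx1 yx2] /andP[yz1 yz2] [/(mulfI T1_neq0) <-] eq2 eq3 /(mulfI T2_neq0) <-.
have T_neq0 : T1 * y x1 != 0 by rewrite mulf_neq0.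
have xz2 : x2 = z2.
  have div_y (x : F) : y x != 0 -> T1 * y x1 / y x * x = T1 * y x1 * ((y x)^-1 + th).
    by move=> yx_neq0; rewrite -{2}(ordinateK th_neq0 x); field.
  apply: (ordinate_inj th_neq0); apply/invr_inj/(addIr th)/(mulfI T_neq0).
  by rewrite /= -!div_y.
by rewrite -xz2 in eq3 *; rewrite (mulfI _ eq3) // mulf_neq0 ?invr_neq0.
Qed.

End LegsAndBridges.

Section StableSets.
Variable F : finFieldType.
Implicit Types (R : {set F}) (h : F).
Local Open Scope ring_scope.

Definition stabilizes h R := {in R, forall r, r * h \in R}.

Lemma stabilizesV h R : h != 0 -> stabilizes h R -> stabilizes h^-1 R.
Proof.
move=> h_neq0 hR r; have {1}<- : [set q * h | q in R] = R.
  apply/eqP; rewrite eqEcard card_imset ?leqnn ?andbT; last exact: mulIf.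
  by apply/subsetP=> _ /imsetP[q qR ->]; apply: hR.
by case/imsetP=> q qR ->; rewrite mulfK.
Qed.

Lemma stabilizesM h k R : stabilizes h R -> stabilizes k R -> stabilizes (h * k) R.
Proof. by move=> hR kR r rR; rewrite mulrA kR ?hR. Qed.

Lemma card_stabilized g t R : #|F|.-1.-primitive_root g -> (0 < t)%N ->
  1 \in R -> stabilizes (g ^+ t) R -> (#|F|.-1 <= t * #|R|)%N.
Proof.
move=> g_prim t_gt0 R1 tR.
have powers_R k : g ^+ (t * k) \in R.
  by elim: k => [|k IH]; rewrite ?muln0 // mulnSr exprD tR.
rewrite -(cardsC1 (0 : F)) -[t in leqRHS]card_ord -cardsT -cardsX.
apply: leq_trans (leq_imset_card (fun lr : 'I_t * F => g ^+ lr.1 * lr.2) _).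
apply: subset_leq_card; apply/subsetP=> z; rewrite !inE => z_neq0.
have [k ->] : {k : 'I_#|F|.-1 | z = g ^+ k}.
  apply: (prim_rootP g_prim); apply: (mulfI z_neq0).
  by rewrite /= -exprS prednK ?expf_card ?mulr1 // ltnW ?finNzRing_gt1.
apply/imsetP; exists (Ordinal (ltn_pmod k t_gt0), g ^+ (t * (k %/ t))).
  by rewrite in_setX in_setT powers_R.
by rewrite -exprD addnC mulnC -divn_eq.
Qed.

End StableSets.

Section Expansions.
Variables (F : finFieldType) (g th : F) (N : nat).
Hypotheses (g_neq0 : g != 0%R) (th_neq0 : th != 0%R).
Variables (X X' : {set F}) (t1 t2 : nat).
Hypotheses (X_line : X \subset line_points (window g N 1) th) (X'X : X' \subset X).
Local Notation y := (ordinate th).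
Local Notation U := (window g N 6).
Local Notation pair := (F * F)%type.

Definition quotient_reps (h : F) : {set F} := [set x in X | (h * x)%R \in X].

Definition multiplier (s : pair) : F := (y s.1 / y s.2)%R.

Definition slope (q : pair * pair) : F := (q.2.1 * y q.2.2 / (q.1.1 * y q.1.2))%R.

(* A datum (s, ((e1, u1), (e2, u2))) consists of a multiplier and of two points e1, e2
   through which legs are routed.  The same set provides the data and their links: in
   the role of a link, e2 and e1 are the points at which a linear form is evaluated. *)
Definition link_data : {set pair * (pair * pair)} :=
  setX (setX X X) (setX (setX X' X) (setX X' X)).

Definition link_invariant (w : pair * (pair * pair)) : F :=
  (multiplier w.1 * slope w.2)%R.

Definition link_data_off (B : {set pair}) : {set pair * (pair * pair)} :=
  [set w in link_data | (w.2.2.1, w.2.1.1) \notin B].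

Definition links (B : {set pair}) w : {set pair * (pair * pair)} :=
  [set w' in link_data_off B | link_invariant w' == link_invariant w].

Definition injective_off (B : {set pair}) (rho : F) :=
  {in setX X' X' &, forall u v, u \notin B ->
     (u.1 + rho * u.2 = v.1 + rho * v.2)%R -> u = v}.

Definition midpoints (c d : F) : {set F} :=
  [set e in X' | (t1 <= #|quotient_reps (e / c)%R|) && (t1 <= #|quotient_reps (e / d)%R|)].

Definition routes (c d : F) : {set pair} :=
  sigma_set (midpoints c d) (fun e => quotient_reps (e / c)%R).

Lemma points_window x : x \in X -> x \in window g N 1.
Proof. by move/(subsetP X_line); rewrite inE => /andP[]. Qed.

Lemma ordinates_window x : x \in X -> y x \in window g N 1.
Proof. by move/(subsetP X_line); rewrite inE => /andP[]. Qed.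

Lemma points_neq0 x : x \in X -> x != 0%R.
Proof. by move/points_window/(window_neq0 g_neq0). Qed.

Lemma ordinates_neq0 x : x \in X -> y x != 0%R.
Proof. by move/ordinates_window/(window_neq0 g_neq0). Qed.

Lemma selected_neq0 x : x \in X' -> x != 0%R.
Proof. by move/(subsetP X'X)/points_neq0. Qed.

Lemma selected_window x : x \in X' -> x \in window g N 1.
Proof. by move/(subsetP X'X)/points_window. Qed.

Lemma multiplier_window s : s \in setX X X -> multiplier s \in window g N 2.
Proof.
rewrite inE => /andP[s1X s2X].
exact: window_div (ordinates_window s1X) (ordinates_window s2X).
Qed.

Lemma multiplier_neq0 s : s \in setX X X -> multiplier s != 0%R.
Proof. by move/multiplier_window/(window_neq0 g_neq0). Qed.

Lemma leg_window k c d v e u w : k + 2 <= 6 -> v \in window g N k ->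
  c \in X -> d \in X -> e \in X -> w \in X -> (e / c * u)%R \in X -> (e / d * w)%R \in X ->
  leg th c d v (e, u, w) \in setX (setX U U) U.
Proof.
move=> k6 vk cX dX eX wX ecu edw.
have entry p q : p \in X -> q \in X -> (v * p * y q)%R \in U.
  move=> pX qX; apply: subsetP (window_leq N g_neq0 k6) _ _; rewrite -(addn1 1) addnA.
  exact: windowM (windowM vk (points_window pX)) (ordinates_window qX).
by rewrite !in_setX !entry.
Qed.

Lemma bridge_window T1 T2 x1 x2 x3 x4 :
  T1 \in window g N 3 -> T2 \in window g N 5 ->
  x1 \in X -> x2 \in X -> x3 \in X -> x4 \in X ->
  bridge th T1 T2 (x1, x2, (x3, x4)) \in setX (setX U U) (setX U U).
Proof.
move=> T1_3 T2_5 x1X x2X x3X x4X.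
have W46 := subsetP (window_leq N g_neq0 (isT : 4 <= 6)).
have T1y_4 : (T1 * y x1)%R \in window g N 4 := windowM T1_3 (ordinates_window x1X).
have T_5 : (T1 * y x1 / y x2)%R \in window g N 5 :=
  window_div g_neq0 T1y_4 (ordinates_window x2X).
rewrite !in_setX (W46 _ (windowM T1_3 (points_window x1X))) /=.
by rewrite !(windowM T_5, windowM T2_5) ?points_window.
Qed.

Section FixedRoutes.
Variables (a b c d : F) (s : pair) (B : {set pair}).
Hypotheses (aX' : a \in X') (bX' : b \in X') (cX' : c \in X') (dX' : d \in X').
Hypotheses (cd : c != d) (sX : s \in setX X X).
Let rho := (multiplier s * ((a - b) / (c - d)))%R.
Hypothesis rho_inj : injective_off B rho.

(* With T1 = v1 e1 y(u1) and T2 = mu v2 e2 y(u2), the leg c -> e1 -> d, the leg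
   b -> e2 -> a and the bridge from T1 to T2 expand (c - d) v1 + mu (a - b) v2. *)
Definition expansion (o : (pair * pair) * (pair * (pair * (pair * pair)))) :
    (F * F * F) * (F * F * F) * (pair * pair) :=
  let: (((e1, u1), (e2, u2)), ((w1, w2), (x, ((v2, x2), (v1, x1))))) := o in
  let mu := multiplier s in
  (leg th c d v1 (e1, u1, w1), leg th b a (mu * v2) (e2, u2, w2),
   bridge th (v1 * e1 * y u1) (mu * v2 * e2 * y u2) (x1, x2, x))%R.

Variable Q : {set pair * pair}.
Hypothesis Q_routes : Q \subset setX (routes c d) (routes b a).

Definition configurations :=
  sigma_set Q (fun q =>
    setX (setX (quotient_reps (q.1.1 / d)) (quotient_reps (q.2.1 / a))) (links B (s, q)))%R.

Definition expansion_total (t : (F * F * F) * (F * F * F) * (pair * pair)) : F :=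
  (bridge_total t.2 - leg_total t.1.1 + leg_total t.1.2)%R.

Lemma configurations_mem e1 u1 e2 u2 w1 w2 x3 x4 v2 x2 v1 x1 :
  (((e1, u1), (e2, u2)), ((w1, w2), ((x3, x4), ((v2, x2), (v1, x1))))) \in configurations ->
  [/\ [/\ e1 \in X', u1 \in X, w1 \in X, (e1 / c * u1)%R \in X & (e1 / d * w1)%R \in X],
      [/\ e2 \in X', u2 \in X, w2 \in X, (e2 / b * u2)%R \in X & (e2 / a * w2)%R \in X],
      [/\ x1 \in X, x2 \in X, x3 \in X & x4 \in X] /\
        [/\ v1 \in X', v2 \in X' & (v1, v2) \notin B] &
      (v1 * e1 * y u1 * y x1 * y x3 = multiplier s * v2 * e2 * y u2 * y x4 * y x2)%R].
Proof.
rewrite !inE /= => /and3P[/(subsetP Q_routes)].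
rewrite !inE /= => /andP[/andP[/andP[e1X' _] /andP[u1X ecu1]]].
move=> /andP[/andP[e2X' _] /andP[u2X ecu2]].
move=> /andP[/andP[w1X edw1] /andP[w2X edw2]].
move=> /andP[/andP[/andP[/andP[x3X x4X] /andP[/andP[v2X' x2X] /andP[v1X' x1X]]] nB] /eqP].
rewrite /link_invariant /slope /= => eq_inv; split=> //.
transitivity (multiplier (x3, x4) * (v1 * y x1 / (v2 * y x2)) *
              (y x4 * v2 * y x2 * e1 * y u1))%R.
  by rewrite /multiplier /=; field; rewrite !ordinates_neq0 ?selected_neq0.
by rewrite eq_inv; field; rewrite ordinates_neq0 ?selected_neq0.
Qed.

Definition expansion_box : {set (F * F * F) * (F * F * F) * (pair * pair)} :=
  setX (setX (setX (setX U U) U) (setX (setX U U) U)) (setX (setX U U) (setX U U)).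

Lemma expansion_window o : o \in configurations -> expansion o \in expansion_box.
Proof.
case: o => -[[e1 u1] [e2 u2]] [[w1 w2] [[x3 x4] [[v2 x2] [v1 x1]]]].
case/configurations_mem => [[e1X' u1X w1X leg1c leg1d] [e2X' u2X w2X leg2b leg2a]].
case=> -[x1X x2X x3X x4X] [v1X' v2X' _] _.
have X'P := subsetP X'X.
have mv2_3 : (multiplier s * v2)%R \in window g N 3.
  exact: windowM (multiplier_window sX) (selected_window v2X').
apply/setXP; split; [apply/setXP; split|].
- exact: leg_window (selected_window v1X') (X'P _ cX') (X'P _ dX') (X'P _ e1X') w1X leg1c leg1d.
- exact: leg_window mv2_3 (X'P _ bX') (X'P _ aX') (X'P _ e2X') w2X leg2b leg2a.
- apply: bridge_window => //.
    exact: windowM (windowM (selected_window v1X') (selected_window e1X')) (ordinates_window u1X).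
  exact: windowM (windowM mv2_3 (selected_window e2X')) (ordinates_window u2X).
Qed.

Lemma expansion_totalE e1 u1 e2 u2 w1 w2 x3 x4 v2 x2 v1 x1 :
  let o := (((e1, u1), (e2, u2)), ((w1, w2), ((x3, x4), ((v2, x2), (v1, x1))))) in
  o \in configurations ->
  (th * expansion_total (expansion o) = (c - d) * (v1 + rho * v2))%R.
Proof.
move=> o /configurations_mem[_ _ [[_ x2X _ _] _] balance].
rewrite /expansion_total /= (bridge_totalE th_neq0 (ordinates_neq0 x2X) balance).
have leg1 := leg_totalE th_neq0 v1 e1 u1 w1 (selected_neq0 cX') (selected_neq0 dX').
have leg2 := leg_totalE th_neq0 (multiplier s * v2)%R e2 u2 w2
  (selected_neq0 bX') (selected_neq0 aX').
transitivity (v1 * (c - d) - multiplier s * v2 * (b - a))%R.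
  by rewrite -leg1 -leg2; ring.
by rewrite /rho; field; rewrite subr_eq0.
Qed.

(* The total recovers v1 + rho v2, hence v1 and v2; then the legs give T1 and T2. *)
Lemma expansion_inj : {in configurations &, injective expansion}.
Proof.
move=> [[[e1 u1] [e2 u2]] [[w1 w2] [[x3 x4] [[v2 x2] [v1 x1]]]]].
move=> [[[e1' u1'] [e2' u2']] [[w1' w2'] [[x3' x4'] [[v2' x2'] [v1' x1']]]]] oC o'C eq_exp.
have := expansion_totalE oC; rewrite eq_exp (expansion_totalE o'C).
move/mulfI; rewrite subr_eq0 cd => /(_ isT)/esym eq_form; move: eq_exp.
case/configurations_mem: oC => [[e1X' u1X _ _ _] [e2X' u2X _ _ _]].
case=> -[x1X x2X _ _] [v1X' v2X' v_offB] _.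
case/configurations_mem: o'C => [[e1'X' _ _ _ _] [e2'X' _ _ _ _]].
case=> -[x1'X x2'X _ _] [v1'X' v2'X' _] _.
have [<- <-] : (v1, v2) = (v1', v2').
  by apply: (@rho_inj (v1, v2) (v1', v2')) eq_form; rewrite ?in_setX ?v1X' ?v2X' ?v1'X' ?v2'X'.
have mv2_neq0 : (multiplier s * v2 != 0)%R.
  exact: mulf_neq0 (multiplier_neq0 sX) (selected_neq0 v2X').
move=> eq_exp; have eq_leg1 : (e1, u1, w1) = (e1', u1', w1').
  by apply: (leg_inj th_neq0) (congr1 (fun t => t.1.1) eq_exp); rewrite ?inE /= ?selected_neq0.
have eq_leg2 : (e2, u2, w2) = (e2', u2', w2').
  apply: (leg_inj th_neq0) (congr1 (fun t => t.1.2) eq_exp);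
    by rewrite ?inE /= ?mv2_neq0 ?selected_neq0.
move: eq_exp; case: eq_leg1 eq_leg2 => <- <- <- [<- <- <-] eq_exp.
suff [<- <- <- <-] : (x1, x2, (x3, x4)) = (x1', x2', (x3', x4')) by [].
apply: (bridge_inj th_neq0) (congr1 snd eq_exp); rewrite ?inE /= ?ordinates_neq0 //.
  exact: mulf_neq0 (mulf_neq0 (selected_neq0 v1X') (selected_neq0 e1X')) (ordinates_neq0 u1X).
exact: mulf_neq0 (mulf_neq0 mv2_neq0 (selected_neq0 e2X')) (ordinates_neq0 u2X).
Qed.

Lemma expansion_count : {in Q, forall q, t2 <= #|links B (s, q)|} ->
  #|Q| * (t1 ^ 2 * t2) <= #|U| ^ 10.
Proof.
move=> links_t2; apply: leq_trans (_ : #|configurations| <= _).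
  apply: leq_card_sigma_set => -[[e1 u1] [e2 u2]] qQ; rewrite !cardsX -mulnn.
  have := subsetP Q_routes _ qQ; rewrite !inE /=.
  case/andP=> /andP[/and3P[_ _ t1d] _] /andP[/and3P[_ _ t1a] _].
  by rewrite !leq_mul // links_t2.
rewrite -(card_in_imset expansion_inj) (_ : #|U| ^ 10 = #|expansion_box|).
  by apply: subset_leq_card; apply/subsetP=> _ /imsetP[o oC ->]; apply: expansion_window.
by rewrite !cardsX; ring.
Qed.

End FixedRoutes.

Definition difference_ratios : {set F} :=
  [set (u.1 - u.2) / (v.1 - v.2) | u in [set u in setX X' X' | u.1 != u.2],
                                   v in [set v in setX X' X' | v.1 != v.2]]%R.

Lemma difference_ratiosP r :
  reflect (exists a b c d, [/\ [/\ a \in X', b \in X', c \in X' & d \in X'],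
             a != b, c != d & r = (a - b) / (c - d)]%R)
          (r \in difference_ratios).
Proof.
apply: (iffP imset2P) => [[[a b] [c d]]|[a [b [c [d [[aX' bX' cX' dX'] ab cd ->]]]]]].
  by rewrite !inE /= => /andP[/andP[? ?] ?] /andP[/andP[? ?] ?] ->; exists a, b, c, d.
by exists (a, b) (c, d); rewrite ?inE /= ?aX' ?bX' ?cX' ?dX'.
Qed.

Lemma difference_ratios_neq0 r : r \in difference_ratios -> r != 0%R.
Proof.
by case/difference_ratiosP=> a [b [c [d [_ ab cd ->]]]]; rewrite mulf_neq0 ?invr_neq0 ?subr_eq0.
Qed.

Lemma difference_ratios1 : 1 < #|X'| -> 1%R \in difference_ratios.
Proof.
move=> /card_gt1P[a [b [aX' bX' ab]]].
by apply/difference_ratiosP; exists a, b, a, b; rewrite divff ?subr_eq0.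
Qed.

Definition collisions (rho : F) : {set pair * pair} :=
  [set w in setX (setX X' X') (setX X' X') |
    (w.1 != w.2) && (w.1.1 + rho * w.1.2 == w.2.1 + rho * w.2.2)%R].

Lemma injective_off_collisions rho : injective_off [set w.1 | w in collisions rho] rho.
Proof.
move=> u v uX' vX' uB eq_form; apply: contraNeq uB => uv.
by apply/imsetP; exists (u, v); rewrite // inE in_setX uX' vX' uv /= eq_form.
Qed.

Lemma collisions_ratio rho w : rho != 0%R -> w \in collisions rho ->
  rho = ((w.1.1 - w.2.1) / (w.2.2 - w.1.2))%R /\ rho \in difference_ratios.
Proof.
move=> rho_neq0; case: w => -[u1 u2] [v1 v2]; rewrite !inE /=.
case/andP=> /andP[/andP[u1X' u2X'] /andP[v1X' v2X']] /andP[uv /eqP eq_form].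
have u2v2 : v2 != u2.
  by apply: contraNneq uv => v2E; move: eq_form; rewrite v2E => /addIr->.
have rhoE : rho = ((u1 - v1) / (v2 - u2))%R.
  apply: (mulIf (_ : v2 - u2 != 0)%R); rewrite ?subr_eq0 // divfK ?subr_eq0 //.
  by rewrite mulrBr -[u1](addrK (rho * u2)%R) eq_form; ring.
split=> //; apply/difference_ratiosP; exists u1, v1, v2, u2; split=> //.
by apply: contraNneq rho_neq0 => u1E; rewrite rhoE u1E subrr mul0r.
Qed.

Lemma injective_off_notin_ratios rho :
  rho != 0%R -> rho \notin difference_ratios -> injective_off set0 rho.
Proof.
move=> rho_neq0 rho_ratio; have no_collision : collisions rho = set0.
  by apply/setP=> w; rewrite in_set0; apply: contraNF rho_ratio => /(collisions_ratio rho_neq0)[].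
by have := @injective_off_collisions rho; rewrite no_collision imset0.
Qed.

Lemma exists_few_collisions m : 1 < #|X'| -> #|X'| <= m ->
  exists2 r, r \in difference_ratios & #|difference_ratios| * #|collisions r| <= m ^ 4.
Proof.
move=> X'_gt1 X'm; have ratios_gt0 : 0 < #|difference_ratios|.
  by apply/card_gt0P; exists 1%R; apply: difference_ratios1.
have [r r_ratio le_avg] := exists_le_average (fun r => #|collisions r|) ratios_gt0.
exists r => //; apply: leq_trans le_avg _.
rewrite -card_sigma_set -(@card_in_imset _ _ snd); last first.
  move=> [q w] [q' w']; rewrite inE => /andP[/= /difference_ratios_neq0 q_neq0 qw].
  rewrite inE => /andP[/= /difference_ratios_neq0 q'_neq0 q'w'] /= ww'.
  rewrite -ww' in q'w' *; have [-> _] := collisions_ratio q_neq0 qw.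
  by have [-> _] := collisions_ratio q'_neq0 q'w'.
apply: (@leq_trans #|setX (setX X' X') (setX X' X')|).
  apply: subset_leq_card; apply/subsetP=> _ /imsetP[[q w] + ->].
  by rewrite inE /= => /andP[_]; rewrite inE => /andP[].
by rewrite !cardsX (_ : m ^ 4 = m * m * (m * m)) ?leq_mul //; ring.
Qed.

Lemma link_invariant_window w : w \in link_data -> link_invariant w \in U.
Proof.
case: w => s [[e1 u1] [e2 u2]]; rewrite in_setX /= => /andP[sX]; rewrite !inE /=.
case/andP=> /andP[/(subsetP X'X)e1X u1X] /andP[/(subsetP X'X)e2X u2X].
apply: windowM (multiplier_window sX) (_ : _ \in window g N (2 + 2)).
exact: window_div (windowM (points_window e2X) (ordinates_window u2X))
                  (windowM (points_window e1X) (ordinates_window u1X)).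
Qed.

Lemma card_link_data_on (B : {set pair}) : #|link_data :\: link_data_off B| <= #|B| * #|X| ^ 4.
Proof.
pose f (w : pair * (pair * pair)) :=
  ((w.2.2.1, w.2.1.1), (w.1, (w.2.1.2, w.2.2.2))).
have f_inj : injective f by move=> [s [[a b] [c d]]] [s' [[a' b'] [c' d']]] [-> -> -> -> ->].
rewrite -(card_imset _ f_inj) (_ : #|B| * _ = #|setX B (setX (setX X X) (setX X X))|).
  apply: subset_leq_card; apply/subsetP=> _ /imsetP[[s [[e1 u1] [e2 u2]]] + ->].
  rewrite in_setD => /andP[+ w_link]; rewrite inE w_link negbK in_setX => -> /=.
  by move: w_link; rewrite !inE => /andP[-> /andP[/andP[_ ->] /andP[_ ->]]].
by rewrite !cardsX; ring.
Qed.

Section TypicalMultipliers.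
Variables (m t0 : nat).
Hypothesis midpoints_card : {in X' &, forall c d, m <= 2 * #|midpoints c d|}.

Lemma card_routes : {in X' &, forall c d, m * t1 <= 2 * #|routes c d|}.
Proof.
move=> c d cX' dX'; apply: leq_trans (leq_mul (midpoints_card cX' dX') (leqnn t1)) _.
rewrite -mulnA leq_mul2l leq_card_sigma_set // => e.
by rewrite inE => /and3P[].
Qed.

Definition rarely_linked (B : {set pair}) (s : pair) : {set pair * pair} :=
  [set q in setX (setX X' X) (setX X' X) | #|links B (s, q)| < t2].

Definition typical (B : {set pair}) : {set pair} :=
  [set s in setX X X | 8 * #|rarely_linked B s| <= (m * t1) ^ 2].

Lemma typical_multiplier_neq0 B s : s \in typical B -> multiplier s != 0%R.
Proof. by rewrite inE => /andP[/multiplier_neq0]. Qed.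

Lemma typicalS (A B : {set pair}) : A \subset B -> typical B \subset typical A.
Proof.
move=> AB; apply/subsetP=> s; rewrite !inE => /andP[-> /=]; apply: leq_trans.
rewrite leq_mul2l subset_leq_card //; apply/subsetP=> q; rewrite !inE => /andP[-> /=].
apply: leq_ltn_trans; apply: subset_leq_card; apply/subsetP=> w; rewrite !inE.
by case/andP=> /andP[-> nB ->]; rewrite andbT; apply: contra nB; apply: (subsetP AB).
Qed.

Lemma sum_rarely_linked_le (B : {set pair}) :
  \sum_(s in setX X X) #|rarely_linked B s| <= #|U| * t2 + #|B| * #|X| ^ 4.
Proof.
rewrite -card_sigma_set; set S := sigma_set _ _.
rewrite -(cardsID (link_data_off B) S); apply: leq_add; last first.
  apply: leq_trans (subset_leq_card _) (card_link_data_on B); apply: setSD.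
  by apply/subsetP=> -[s q]; rewrite !inE /= => /and3P[-> ->].
have inU : {in link_data_off B, forall w, link_invariant w \in U}.
  by move=> w; rewrite inE => /andP[/link_invariant_window].
apply: leq_trans (card_small_fibers t2 inU); apply: subset_leq_card.
apply/subsetP=> -[s q]; rewrite 2!inE => /andP[+ sq_off]; rewrite inE sq_off.
by rewrite inE => /andP[_]; rewrite inE => /andP[_].
Qed.

Lemma card_typical (B : {set pair}) : 0 < m * t1 ->
  32 * (#|U| * t2) <= (m * t1) ^ 2 * #|X| ^ 2 ->
  32 * (#|B| * #|X| ^ 4) <= (m * t1) ^ 2 * #|X| ^ 2 ->
  #|X| ^ 2 <= 2 * #|typical B|.
Proof.
move=> mt1_gt0 t2_le B_le; set K := (m * t1) ^ 2 in t2_le B_le *.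
have := markov_card (setX X X) (fun s => #|rarely_linked B s|) (K %/ 8).+1.
move=> /leq_trans/(_ (sum_rarely_linked_le B)).
have cX : #|X| ^ 2 = #|typical B| + #|[set s in setX X X | K %/ 8 < #|rarely_linked B s|]|.
  rewrite -mulnn -cardsX -(cardsID (typical B) (setX X X)); congr (_ + _).
    by congr #|pred_of_set _|; apply/setIidPr/subsetP=> s; rewrite inE => /andP[].
  apply: eq_card => s; rewrite in_setD [in LHS]inE [in RHS]inE.
  by rewrite ltn_divLR // mulnC ltnNge; case: (s \in _); rewrite ?andbF //= andbT.
have : K < 8 * (K %/ 8).+1 by rewrite mulnC ltn_ceil.
have : 0 < K by rewrite expn_gt0 mt1_gt0.
move: t2_le B_le cX; move: (K %/ 8).+1 (K) #|typical B| #|[set s in _ | _]| => e k x z.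
move: (#|X| ^ 2) (#|U| * t2) (#|B| * _) => n2 u b; nia.
Qed.

(* Otherwise (c - d) v1 + mu (a - b) v2 would have more expansions than U allows. *)
Lemma typical_ratio_notin (B : {set pair}) rho s :
  8 * #|U| ^ 10 < (m * t1) ^ 2 * (t1 ^ 2 * t2) -> injective_off B rho ->
  s \in typical B -> (rho / multiplier s)%R \notin difference_ratios.
Proof.
move=> U_small rho_inj; rewrite inE => /andP[sX rare]; apply/negP.
case/difference_ratiosP=> a [b [c [d [[aX' bX' cX' dX'] _ cd rho_def]]]].
have {rho_def}rhoE : rho = (multiplier s * ((a - b) / (c - d)))%R.
  by rewrite -rho_def mulrC divfK ?multiplier_neq0.
set K := (m * t1) ^ 2 in U_small rare *; pose P := setX (routes c d) (routes b a).
pose Q := P :\: rarely_linked B s.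
have Q_routes : Q \subset P by apply: subsetDl.
have Q_linked : {in Q, forall q, t2 <= #|links B (s, q)|}.
  move=> q; rewrite in_setD inE negb_and -leqNgt => /andP[/orP[|//] + q_routes].
  case/negP; move: q_routes; case: q => [[e1 u1] [e2 u2]]; rewrite !inE /=.
  by case/andP=> /andP[/andP[-> _] /andP[-> _]] /andP[/andP[-> _] /andP[-> _]].
have large_Q : K <= 8 * #|Q|.
  have large_P : K <= 2 * 2 * #|P|.
    by rewrite cardsX mulnACA /K -mulnn leq_mul ?card_routes.
  have : #|P| <= #|rarely_linked B s| + #|Q|.
    by rewrite -(cardsID (rarely_linked B s) P) leq_add2r subset_leq_card ?subsetIr.
  by move: rare large_P; move: (K) #|P| #|Q| #|_|; clear; lia.
rewrite rhoE in rho_inj; have := expansion_count aX' bX' cX' dX' cd sX rho_inj Q_routes Q_linked.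
rewrite -(leq_pmul2l (isT : 0 < 8)); apply/negP; rewrite -ltnNge; apply: leq_trans U_small _.
by rewrite [leqRHS]mulnA leq_mul2r large_Q orbT.
Qed.

Lemma typical_stabilizes s : 8 * #|U| ^ 10 < (m * t1) ^ 2 * (t1 ^ 2 * t2) ->
  s \in typical set0 -> stabilizes (multiplier s) difference_ratios.
Proof.
move=> U_small s_typ r r_ratio; have mu_neq0 := typical_multiplier_neq0 s_typ.
have r_neq0 := difference_ratios_neq0 r_ratio.
apply: contraLR r_ratio => r_mu; rewrite -(mulfK mu_neq0 r).
apply: typical_ratio_notin s_typ => //; apply: injective_off_notin_ratios => //.
exact: mulf_neq0.
Qed.

Lemma exists_typical_shift : 0 < #|X| -> 0 < t0 -> 2 * (2 * N %/ t0).+1 < #|X| ->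
  8 * #|U| ^ 10 < (m * t1) ^ 2 * (t1 ^ 2 * t2) -> #|X| ^ 2 <= 2 * #|typical set0| ->
  exists2 t, 0 < t < t0 & stabilizes (g ^+ t)%R difference_ratios.
Proof.
move=> X_gt0 t0_gt0 blocks U_small many_typical.
have [|x xX large_fiber] := exists_large_fiber (D := typical set0) X_gt0.
  by move=> s; rewrite inE => /andP[]; rewrite inE => /andP[].
pose A := [set y z | z in [set z | (x, z) \in typical set0]].
have A_ordinates z : (x, z) \in typical set0 -> z \in X.
  by rewrite inE => /andP[]; rewrite in_setX => /andP[].
have [||_ [_ [t [/imsetP[z + ->] /imsetP[z' + ->] t_lt yz'E]]]] :=
    @window_close_pair _ g N g_neq0 1 t0 A t0_gt0.
- by apply/subsetP=> _ /imsetP[z + ->]; rewrite inE => /A_ordinates/ordinates_window.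
- rewrite card_imset ?muln1; last exact: ordinate_inj.
  rewrite -(ltn_pmul2l (isT : 0 < 2)); apply: leq_trans blocks _.
  by rewrite -(leq_pmul2l X_gt0) mulnn mulnCA (leq_trans many_typical) // leq_mul2l.
rewrite inE => xz; rewrite inE => xz'; exists t => //.
have yx := ordinates_neq0 xX; have yz := ordinates_neq0 (A_ordinates _ xz).
have -> : (g ^+ t = (multiplier (x, z'))^-1 * multiplier (x, z))%R.
  by rewrite /multiplier /= yz'E; field; rewrite yx yz expf_neq0.
apply: stabilizesM; last exact: typical_stabilizes.
exact: stabilizesV (typical_multiplier_neq0 xz') (typical_stabilizes U_small xz').
Qed.

(* A stable set of ratios is so large that one of its elements r has few collisions;
   dividing r by a multiplier typical for r then leaves the set and stays inside. *)
Lemma expansion_bound : 0 < m * t1 -> 1 < #|X'| -> #|X'| <= m -> 0 < t0 ->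
  2 * (2 * N %/ t0).+1 < #|X| ->
  32 * (#|U| * t2) <= (m * t1) ^ 2 * #|X| ^ 2 ->
  32 * t0 * m ^ 2 * #|X| ^ 2 <= t1 ^ 2 * #|F|.-1 ->
  (#|F|.-1.-primitive_root g)%R ->
  (m * t1) ^ 2 * (t1 ^ 2 * t2) <= 8 * #|U| ^ 10.
Proof.
move=> mt1_gt0 X'_gt1 X'm t0_gt0 blocks t2_le F_large g_prim.
rewrite leqNgt; apply/negP=> U_small.
have X_gt0 : 0 < #|X| by apply: leq_trans blocks.
have [|t /andP[t_gt0 t_lt] t_stab] := exists_typical_shift X_gt0 t0_gt0 blocks U_small.
  by apply: card_typical; rewrite ?cards0.
have F_le := card_stabilized g_prim t_gt0 (difference_ratios1 X'_gt1) t_stab.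
have [r r_ratio few_collisions] := exists_few_collisions X'_gt1 X'm.
pose B := [set w.1 | w in collisions r].
have card_B : #|F|.-1 * #|B| <= t0 * m ^ 4.
  apply: leq_trans (leq_mul F_le (leq_imset_card _ _)) _; rewrite -mulnA.
  by apply: leq_mul (ltnW t_lt) few_collisions.
have : 32 * (#|B| * #|X| ^ 4) <= (m * t1) ^ 2 * #|X| ^ 2.
  have F_gt0 := prim_order_gt0 g_prim.
  rewrite -(leq_pmul2l F_gt0); apply: (@leq_trans (32 * (t0 * m ^ 4) * #|X| ^ 4)).
    by rewrite mulnCA -[leqRHS]mulnA leq_mul2l mulnA leq_mul2r card_B !orbT.
  by have := leq_mul F_large (leqnn (m ^ 2 * #|X| ^ 2)); rewrite (_ : 4 = 2 + 2) // !expnD; lia.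
move/(card_typical mt1_gt0 t2_le) => many_typical.
have /card_gt0P[s s_typ] : 0 < #|typical B| by move: many_typical X_gt0; clear; nia.
have s_typ0 := subsetP (typicalS (sub0set B)) _ s_typ.
have mu_neq0 := typical_multiplier_neq0 s_typ.
have := stabilizesV mu_neq0 (typical_stabilizes U_small s_typ0) r_ratio; apply/negP.
exact: typical_ratio_notin U_small (@injective_off_collisions r) s_typ.
Qed.

End TypicalMultipliers.

End Expansions.

(** * Points of a geometric progression on a line *)

(* Locked because unification must not compute it in unary. *)
Definition growth_constant : nat := locked (2 ^ 164).

Lemma growth_constant_gt0 : 0 < growth_constant.
Proof. by rewrite /growth_constant -lock expn_gt0. Qed.

Section LinePointsBound.
Variables (F : finFieldType) (g th : F) (N : nat).
Hypotheses (g_neq0 : g != 0%R) (th_neq0 : th != 0%R).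

Lemma card_quotient_reps (X : {set F}) h : 0%R \notin X ->
  #|quotient_reps X h| = #|[set w in setX X X | w.2 / w.1 == h]%R|.
Proof.
move=> X0; have X_neq0 x : x \in X -> x != 0%R by apply: contraTneq => ->.
rewrite -(@card_imset _ _ (fun x => (x, h * x)%R)); last by move=> x z [].
apply: eq_card => -[x z]; rewrite inE in_setX /=.
apply/imsetP/andP=> [[x' + [-> ->]]|[/andP[xX zX] /eqP<-]].
  by rewrite inE => /andP[x'X hx'X]; rewrite x'X hx'X mulfK ?X_neq0.
by exists x; rewrite ?inE divfK ?X_neq0 ?xX.
Qed.

Section Selection.
Variables (X : {set F}) (t1 : nat).
Hypothesis X_line : X \subset line_points (window g N 1) th.

Definition unpopular (c e : F) := (c != e) && (#|quotient_reps X (e / c)%R| < t1).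

Lemma unpopular_irr : irreflexive unpopular.
Proof. by move=> c; rewrite /unpopular eqxx. Qed.

Lemma card_unpopular : #|edges unpopular X| <= #|window g N 2| * t1.
Proof.
have X0 : 0%R \notin X by apply/negP=> /(points_neq0 g_neq0 X_line)/eqP.
have quotients_window : {in setX X X, forall w, (w.2 / w.1)%R \in window g N 2}.
  move=> w; rewrite inE => /andP[w1X w2X].
  exact: window_div (points_window X_line w2X) (points_window X_line w1X).
apply: leq_trans (card_small_fibers t1 quotients_window); apply: subset_leq_card.
apply/subsetP=> w; rewrite !inE => /andP[-> /andP[_]].
by rewrite card_quotient_reps.
Qed.

Lemma popular_quotient c e : t1 <= #|X| -> c \in X -> ~~ unpopular c e ->
  t1 <= #|quotient_reps X (e / c)%R|.
Proof.
move=> t1X cX; rewrite negb_and negbK -leqNgt => /orP[/eqP<-|//].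
rewrite divff ?(points_neq0 g_neq0 X_line) // (leq_trans t1X) // subset_leq_card //.
by apply/subsetP=> x xX; rewrite inE mul1r xX.
Qed.

Lemma card_midpoints (Z : {set F}) m : t1 <= #|X| -> Z \subset X -> 5 * m <= 6 * #|Z| ->
  {in Z, forall c, 6 * #|[set e in Z | unpopular c e]| <= m} ->
  {in Z &, forall c d, m <= 2 * #|midpoints X Z t1 c d|}.
Proof.
move=> t1X ZX large_Z Z_popular c d cZ dZ; pose bad b := [set e in Z | unpopular b e].
have : #|Z| <= #|midpoints X Z t1 c d| + #|bad c| + #|bad d|.
  have /subset_leq_card/leq_trans : Z \subset midpoints X Z t1 c d :|: bad c :|: bad d.
    apply/subsetP=> e eZ; rewrite !inE eZ /=.
    have := popular_quotient (e := e) t1X (subsetP ZX _ cZ).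
    have := popular_quotient (e := e) t1X (subsetP ZX _ dZ).
    by do 2!case: unpopular; rewrite ?orbT //= => -> // ->.
  by apply; rewrite !(leq_trans (leq_card_setU _ _)) ?leq_add2r ?leq_card_setU.
by have := Z_popular c cZ; have := Z_popular d dZ; rewrite -!/(bad _); lia.
Qed.

Lemma line_points_expansion_bound m t0 t2 :
  (#|F|.-1.-primitive_root g)%R -> 0 < t0 -> 0 < t1 -> 2 < m -> m <= #|X| -> t1 <= #|X| ->
  36 * (#|window g N 2| * t1) <= #|X| ^ 2 ->
  2 * (2 * N %/ t0).+1 < #|X| ->
  32 * (#|window g N 6| * t2) <= (m * t1) ^ 2 * #|X| ^ 2 ->
  32 * t0 * m ^ 2 * #|X| ^ 2 <= t1 ^ 2 * #|F|.-1 ->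
  (m * t1) ^ 2 * (t1 ^ 2 * t2) <= 8 * #|window g N 6| ^ 10.
Proof.
move=> g_prim t0_gt0 t1_gt0 m_gt2 mX t1X t1_le blocks t2_le F_large.
have X_popular : 6 ^ 2 * #|edges unpopular X| <= #|X| ^ 2.
  by apply: leq_trans t1_le; rewrite leq_mul2l card_unpopular.
have [Z [ZX Zm large_Z Z_popular]] :=
  sparse_regular_subset unpopular_irr (isT : 0 < 6) mX X_popular.
have Z_midpoints := card_midpoints t1X ZX large_Z Z_popular.
apply: (expansion_bound g_neq0 th_neq0 X_line ZX Z_midpoints _ _ Zm t0_gt0) => //.
  by rewrite muln_gt0 t1_gt0 (leq_trans _ m_gt2).
by move: large_Z m_gt2; clear; lia.
Qed.

End Selection.

Hypothesis g_prim : (#|F|.-1.-primitive_root g)%R.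
Hypothesis N_small : N ^ 2 <= #|F|.-1.

Section ParameterChoice.
Variables (k m : nat) (X : {set F}).
Hypotheses (k_ge : 512 <= k) (m_gt2 : 2 < m).
Hypothesis X_line : X \subset line_points (window g N 1) th.
Hypothesis cardX : #|X| = 2 ^ 10 * (k * m).
Hypotheses (N_ge : #|X| * k <= N) (N_le : N <= 2 * (#|X| * k)).

Lemma card_window_le i : 0 < i -> #|window g N i| <= (4 * i + 2) * (#|X| * k).
Proof.
move=> i_gt0; apply: leq_trans (card_window _ _ _) _.
have Xk_gt0 : 0 < #|X| * k.
  by rewrite cardX -mulnA muln_gt0 expn_gt0 !muln_gt0 (leq_trans _ k_ge) // (leq_trans _ m_gt2).
by move: N_le Xk_gt0; clear; nia.
Qed.

(* The parameters are t1 = m, t0 = 16 k and t2 = m ^ 5. *)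
Lemma line_points_parameter_growth :
  (m * m) ^ 2 * (m ^ 2 * m ^ 5) <= 8 * #|window g N 6| ^ 10.
Proof.
have k_gt0 : 0 < k by apply: leq_trans k_ge.
have mX : m <= #|X| by rewrite cardX mulnA leq_pmull // muln_gt0 expn_gt0.
have km_le : 832 * (k * m) <= #|X| by rewrite cardX leq_mul2r orbT.
apply: (line_points_expansion_bound X_line (t0 := 16 * k)) => //.
- by rewrite muln_gt0.
- exact: ltnW (ltnW m_gt2).
- apply: leq_trans (leq_mul (leqnn 36) (leq_mul (card_window_le _) (leqnn m))) _ => //.
  by move: km_le; clear; nia.
- have : 2 * N %/ (16 * k) <= 256 * (k * m).
    apply: leq_trans (leq_div2r _ (leq_mul (leqnn 2) N_le)) _.
    rewrite cardX (_ : 2 * _ = 256 * (k * m) * (16 * k)); last by ring.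
    by rewrite mulnK // muln_gt0.
  by rewrite cardX; move: k_gt0 m_gt2; clear; nia.
- apply: leq_trans (leq_mul (leqnn 32) (leq_mul (card_window_le _) (leqnn _))) _ => //.
  by have := leq_mul km_le (leqnn (#|X| * m ^ 4)); clear; lia.
- apply: leq_trans (leq_mul (leqnn (m ^ 2)) N_small).
  apply: (@leq_trans (m ^ 2 * (#|X| * k) ^ 2)); last by rewrite leq_mul2l leq_sqr N_ge orbT.
  by have := leq_mul k_ge (leqnn (k * m ^ 2 * #|X| ^ 2)); clear; lia.
Qed.

Lemma line_points_parameter_bound : 2 ^ 11 * m <= growth_constant * k ^ 20.
Proof.
have window_pow : #|window g N 6| ^ 10 <= (2 ^ 15 * (k ^ 2 * m)) ^ 10.
  by rewrite leq_exp2r // (leq_trans (card_window_le _)) // cardX; clear; lia.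
have m10_gt0 : 0 < m ^ 10 by rewrite expn_gt0 (leq_trans _ m_gt2).
have := leq_trans line_points_parameter_growth (leq_mul (leqnn 8) window_pow).
rewrite (_ : (m * m) ^ 2 * _ = m * m ^ 10); last by ring.
rewrite (expnMn (2 ^ 15)) (expnMn (k ^ 2)) -!expnM mulnA -(expnD 2 3) mulnA leq_pmul2r //.
move=> /(leq_mul (leqnn (2 ^ 11))).
by rewrite /growth_constant -lock [leqRHS]mulnA -(expnD 2 11).
Qed.

End ParameterChoice.

Lemma card_line_points_le k : 512 <= k -> growth_constant * k ^ 22 <= N ->
  #|line_points (window g N 1) th| * k <= N.
Proof.
move=> k_ge N_ge; rewrite leqNgt; apply/negP=> N_lt.
have k_gt0 : 0 < k by apply: leq_trans k_ge.
pose d := 2 ^ 10 * k ^ 2; have d_gt0 : 0 < d by rewrite muln_gt0 !expn_gt0 k_gt0.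
pose m := N %/ d; have m_gt2 : 2 < m.
  rewrite /m (leq_divRL _ _ d_gt0); apply: leq_trans N_ge.
  apply: leq_trans (leq_pmull _ growth_constant_gt0).
  rewrite mulnA (expnD k 20 2) leq_mul2r (leq_trans (_ : _ <= k ^ 2)) ?orbT ?leq_pexp2l //.
  by have := leq_mul k_ge k_ge; rewrite mulnn; apply: leq_trans.
have cE : 2 ^ 10 * (k * m) * k = m * d by rewrite /d; ring.
have md_le : m * d <= N by apply: leq_trunc_div.
have N_lt_md : N < 2 * (m * d).
  apply: leq_trans (ltn_ceil N d_gt0) _; rewrite mulnA leq_mul2r.
  by rewrite mul2n -addnn -addn1 leq_add2l (ltnW (ltnW m_gt2)) orbT.
have [|X X_line cX] := @exists_subset_card _ (line_points (window g N 1) th) (2 ^ 10 * (k * m)).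
  by rewrite -(leq_pmul2r k_gt0) cE (leq_trans md_le) // ltnW.
have : 2 ^ 11 * m <= growth_constant * k ^ 20.
  by apply: (line_points_parameter_bound k_ge m_gt2 X_line cX); rewrite cX cE // ltnW.
rewrite -(@leq_pmul2r (k ^ 2)) ?expn_gt0 ?k_gt0 // -[leqRHS]mulnA -expnD => le_growth.
have := leq_ltn_trans (leq_trans le_growth N_ge) N_lt_md.
by rewrite /d ltnNge => /negP; apply; clear; lia.
Qed.

End LinePointsBound.

(** * Moments of exponential sums *)

Section Moments.
Local Open Scope ring_scope.
Import Order.TTheory Num.Theory.

(* Sum f (f - t)^2 (f + 2 t) >= 0 with t the quotient of the sums of f^2 and f. *)
Lemma sum_sqr_cube_le (K : numFieldType) (I : finType) (f : I -> K) : (forall i, 0 <= f i) ->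
  (\sum_i f i ^+ 2) ^+ 3 <= (\sum_i f i) ^+ 2 * \sum_i f i ^+ 4.
Proof.
move=> f_ge0; set s1 := \sum_i f i; set s2 := \sum_i f i ^+ 2; set s4 := \sum_i f i ^+ 4.
have s1_ge0 : 0 <= s1 by apply: sumr_ge0.
have s2_ge0 : 0 <= s2 by apply: sumr_ge0 => i _; rewrite exprn_ge0.
have [s1_0|s1_neq0] := eqVneq s1 0.
  have -> : s2 = 0.
    apply: big1 => i _; rewrite (_ : f i = 0) ?expr0n //.
    by apply/eqP; move/eqP: s1_0; rewrite psumr_eq0 // => /allP/(_ i (mem_index_enum i)).
  by rewrite s1_0 !expr0n mul0r.
have [t t_ge0 ts1] : exists2 t, 0 <= t & t * s1 = s2.
  by exists (s2 / s1); rewrite ?divfK ?divr_ge0.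
have : 0 <= \sum_i f i * (f i - t) ^+ 2 * (f i + 2 * t).
  apply: sumr_ge0 => i _; apply: mulr_ge0; last by rewrite addr_ge0 ?mulr_ge0.
  by rewrite mulr_ge0 // real_exprn_even_ge0 // rpredB ?ger0_real.
have -> : \sum_i f i * (f i - t) ^+ 2 * (f i + 2 * t) = s4 - t ^+ 2 * s2.
  transitivity (s4 - 3 * t ^+ 2 * s2 + 2 * t ^+ 3 * s1); last by rewrite -ts1; ring.
  rewrite !mulr_sumr -sumrB -big_split; apply: eq_bigr => i _ /=; ring.
rewrite subr_ge0 => /(ler_wpM2l (exprn_ge0 2 s1_ge0)).
by rewrite mulrA -exprMn (mulrC s1) ts1 -exprSr.
Qed.

Variables (C : numClosedFieldType) (p : nat) (z : C).
Hypothesis z_prim : p.-primitive_root z.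

Definition expsum (I : finType) (a : I -> nat) (x : nat) : C := \sum_i z ^+ (a i * x).

Lemma sum_prim_root_expr k l :
  \sum_(x < p) z ^+ (k * x) / z ^+ (l * x) = (p * (k == l %[mod p]))%:R.
Proof.
have zX_neq0 n : z ^+ n != 0.
  by rewrite expf_neq0 // (prim_root_eq0 z_prim) -lt0n (prim_order_gt0 z_prim).
under eq_bigr do rewrite !exprM -expr_div_n.
set w := z ^+ k / z ^+ l; have wE : (w == 1) = (k == l %[mod p])%N.
  by rewrite -(eq_prim_root_expr z_prim) -(inj_eq (mulIf (zX_neq0 l))) divfK ?mul1r.
rewrite -wE; have [->|w_neq1] := eqVneq w 1.
  by under eq_bigr do rewrite expr1n; rewrite sumr_const card_ord muln1.
rewrite muln0; apply: (mulfI (_ : w - 1 != 0)); rewrite ?subr_eq0 // mulr0 -subrX1.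
rewrite expr_div_n -!exprM ![(_ * p)%N]mulnC !exprM (prim_expr_order z_prim).
by rewrite !expr1n divr1 subrr.
Qed.

Lemma norm_prim_root : `|z| = 1.
Proof.
apply/eqP; rewrite -(pexpr_eq1 (prim_order_gt0 z_prim)) //.
by rewrite -normrX (prim_expr_order z_prim) normr1.
Qed.

Lemma norm_expsum_sqr (I : finType) (a : I -> nat) x :
  `|expsum a x| ^+ 2 = \sum_i \sum_j z ^+ (a i * x) / z ^+ (a j * x).
Proof.
rewrite normCK rmorph_sum mulr_suml; apply: eq_bigr => i _; rewrite mulr_sumr.
apply: eq_bigr => j _; rewrite [(_ / _)]/GRing.mul; congr (_ * _).
by rewrite invC_norm normrX norm_prim_root !expr1n invr1 mul1r.
Qed.

Lemma second_moment (I : finType) (a : I -> nat) :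
  \sum_(x < p) `|expsum a x| ^+ 2 =
    (p * #|[set q : I * I | a q.1 == a q.2 %[mod p]]|)%:R.
Proof.
under eq_bigr do rewrite norm_expsum_sqr pair_bigA /=.
rewrite exchange_big /=; under eq_bigr do rewrite sum_prim_root_expr.
by rewrite -natr_sum -big_distrr -sum1dep_card [in RHS]big_mkcond /=; congr (_ * _)%:R.
Qed.

Lemma fourth_moment (I : finType) (a : I -> nat) :
  \sum_(x < p) `|expsum a x| ^+ 4 = (p * modular_energy p a)%:R.
Proof.
rewrite -(second_moment (fun ij : I * I => a ij.1 + a ij.2)%N); apply: eq_bigr => x _.
rewrite (exprM _ 2 2) -normrX; congr (`|_| ^+ 2); rewrite expr2 mulr_suml.
under eq_bigr do rewrite mulr_sumr; rewrite pair_bigA /=.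
by apply: eq_bigr => ij _; rewrite mulnDl exprD.
Qed.

Lemma mean_norm_expsum_ge (I : finType) (a : I -> nat) :
  #|I|%:R ^+ 3 <= (p%:R^-1 * \sum_(x < p) `|expsum a x|) ^+ 2 * (modular_energy p a)%:R.
Proof.
set E := modular_energy p a; set S := \sum_(x < p) _.
have p_gt0 : 0 < p%:R :> C by rewrite ltr0n (prim_order_gt0 z_prim).
have diag_inj : injective (fun i : I => (i, i)) by move=> i j [].
have moment2 : p%:R * #|I|%:R <= \sum_(x < p) `|expsum a x| ^+ 2.
  rewrite second_moment -natrM ler_nat leq_mul2l -(card_imset _ diag_inj).
  apply/orP; right; apply/subset_leq_card/subsetP=> _ /imsetP[i _ ->].
  by rewrite inE eqxx.
have moments : (p%:R * #|I|%:R) ^+ 3 <= S ^+ 2 * (p%:R * E%:R).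
  rewrite -[p%:R * E%:R]natrM -fourth_moment; apply: le_trans (sum_sqr_cube_le _) => //.
  by rewrite lerXn2r // nnegrE ?mulr_ge0 ?sumr_ge0 // => x _; rewrite exprn_ge0.
rewrite -(ler_pM2l (exprn_gt0 3 p_gt0)) -exprMn (le_trans moments) //.
by rewrite le_eqVlt; apply/orP; left; apply/eqP; field; rewrite gt_eqF.
Qed.

End Moments.

Section Cis.
Import Order.TTheory Num.Theory.
Local Open Scope ring_scope.
Local Open Scope complex_scope.

Definition cis (t : R) : R[i] := cos t +i* sin t.
Arguments cis t%_R.

Lemma cis0 : cis 0 = 1.
Proof. by rewrite /cis cos_0 sin_0. Qed.

Lemma cisD s t : cis (s + t) = cis s * cis t.
Proof. by rewrite /cis cosD sinD; simpc; congr (_ +i* _); rewrite addrC. Qed.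

Lemma cisX t n : cis t ^+ n = cis (n%:R * t).
Proof.
elim: n => [|n IH]; first by rewrite mul0r cis0.
by rewrite exprS IH -cisD !mulr_natl mulrS.
Qed.

Lemma cis_2PI : cis (2 * PI) = 1.
Proof. by rewrite /cis cos_2PI sin_2PI. Qed.

Lemma cis_neq1 t : 0 < t < 2 * PI -> cis t != 1.
Proof.
move=> /andP[t_gt0 t_lt]; apply/eqP=> -[cos_t _].
pose h := t / 2; have t_h : t = 2 * h by rewrite /h; field.
have /RltP sin_h : Rlt 0 (sin h).
  by apply: sin_gt_0; apply/RltP; rewrite ?R0E; move: t_gt0 t_lt; rewrite t_h; lra.
have cos_2h : cos t = 1 - 2 * sin h * sin h by rewrite t_h; apply: cos_2a_sin.
by move: cos_2h (mulr_gt0 sin_h sin_h); rewrite cos_t; lra.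
Qed.

Lemma cis_prim_root n : (0 < n)%N -> n.-primitive_root (cis (2 * PI / n%:R)).
Proof.
move=> n_gt0; apply/andP; split=> //; apply/forallP=> i; apply/eqP.
rewrite unity_rootE cisX; have n_neq0 : n%:R != 0 :> R by rewrite pnatr_eq0 -lt0n.
have [->|i_neq] := eqVneq i.+1 n; first by rewrite mulrC divfK // cis_2PI eqxx.
have nR_gt0 : 0 < n%:R :> R by rewrite ltr0n.
have PI2_gt0 : 0 < 2 * PI by rewrite mulr_gt0 ?ltr0n //; apply/RltP/PI_RGT_0.
apply/negbTE/cis_neq1; rewrite mulrCA (mulr_gt0 PI2_gt0) ?divr_gt0 ?ltr0Sn //=.
rewrite gtr_pMr // ltr_pdivrMr // mul1r.
by rewrite ltr_nat ltn_neqAle i_neq ltn_ord.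
Qed.

Lemma sum_cis n (t : 'I_n -> R) :
  \sum_(i < n) cis (t i) = (\sum_(i < n) cos (t i)) +i* (\sum_(i < n) sin (t i)).
Proof. by elim/big_rec3: _ => // i c s z _ ->; rewrite /cis; simpc. Qed.

Lemma sum0E (f : nat -> R) n : sum0 f n = \sum_(i < n) f i.
Proof. by elim: n => [|n IH]; rewrite ?big_ord0 // big_ord_recr /= IH. Qed.

Lemma exp_sum_absE p g N x :
  (exp_sum_abs p g N x)%:C =
    `|expsum (cis (2 * PI / p%:R)) (fun i : 'I_N => g ^ i.+1)%N x|.
Proof.
have angleE i : Rmult (Rmult 2 PI) (Rdiv (Rmult (INR x) (pow (INR g) (S i))) (INR p)) =
    (g ^ i.+1 * x)%:R * (2 * PI / p%:R).
  by rewrite !RealsE /= natrM natrX exprS; ring.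
rewrite /expsum; under eq_bigr do rewrite cisX -angleE.
by rewrite sum_cis normc_def /exp_sum_abs !sum0E RsqrtE RplusE !RpowE.
Qed.

Lemma avg_abs_sum_energy_ge p g N : (0 < p)%N ->
  N%:R ^+ 3 <= avg_abs_sum p g N ^+ 2 * (modular_energy p (fun i : 'I_N => g ^ i.+1)%N)%:R.
Proof.
move=> p_gt0; have := mean_norm_expsum_ge (cis_prim_root p_gt0) (fun i : 'I_N => g ^ i.+1)%N.
rewrite card_ord; under eq_bigr do rewrite -exp_sum_absE.
rewrite -rmorph_sum -!(rmorph_nat (real_complex R)) -fmorphV -rmorphM -!rmorphXn -rmorphM lecR.
by rewrite /avg_abs_sum sum0E !RealsE.
Qed.

End Cis.

(** * Primitive roots and the lower bound *)

Section PrimitiveRoots.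

Lemma Zprime_prime p : Znumtheory.prime (Z.of_nat p) -> prime p.
Proof.
move=> p_prime; have p_ge2 := prime_ge_2 _ p_prime; apply/primeP; split; first by lia.
move=> d /dvdnP[k def_p]; have : (Z.of_nat d | Z.of_nat p)%Z by exists (Z.of_nat k); lia.
move/(prime_divisors _ p_prime) => d_div; apply/orP.
by case: d_div => [|[|[|]]] dE; [lia | left; lia | right; lia | lia].
Qed.

Lemma natpowE a b : Nat.pow a b = a ^ b.
Proof. by elim: b => // b IH; rewrite expnS -IH. Qed.

Lemma nat_moduloE a p : 0 < p -> Nat.modulo a p = a %% p.
Proof.
move=> p_gt0; apply/esym/(Nat.mod_unique _ _ (a %/ p)); first exact/ssrnat.ltP/ltn_pmod.
by rewrite {1}(divn_eq a p) mulnC.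
Qed.

Lemma Fp_eq_mod p a b : prime p -> (a%:R == b%:R :> 'F_p)%R = (a == b %[mod p]).
Proof. by move=> p_prime; rewrite -val_eqE /= !val_Fp_nat. Qed.

Lemma primitive_root_Fp p g : prime p -> primitive_root p g ->
  (p.-1.-primitive_root (g%:R : 'F_p))%R.
Proof.
move=> p_prime [g_unity g_order]; have p_gt1 := prime_gt1 p_prime.
have expE k : (g%:R ^+ k == 1 :> 'F_p)%R = (Nat.modulo (Nat.pow g k) p == 1).
  rewrite natpowE nat_moduloE ?prime_gt0 // -natrX.
  by rewrite (Fp_eq_mod _ 1 p_prime) (modn_small p_gt1).
have p1_gt0 : 0 < p.-1 by rewrite -subn1 subn_gt0.
have [|m m_prim m_dvd] := @prim_order_exists _ p.-1 (g%:R : 'F_p)%R p1_gt0.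
  by apply/eqP; rewrite expE -subn1; apply/eqP.
have := dvdn_leq p1_gt0 m_dvd; rewrite leq_eqVlt => /orP[/eqP<-//|m_lt].
have m_gt0 := prim_order_gt0 m_prim; case: (g_order m); first by lia.
by apply/eqP; rewrite -expE (prim_expr_order m_prim).
Qed.

End PrimitiveRoots.

Lemma leq_mul_expS c k n : 0 < c -> k <= c * k ^ n.+1.
Proof.
move=> c_gt0; apply: leq_trans (leq_pmull _ c_gt0).
by case: k => // k; rewrite -[leqLHS]expn1 leq_pexp2l.
Qed.

Lemma modular_energy_Fp p (I : finType) (a : I -> nat) : prime p ->
  modular_energy p a = energy (fun i => (a i)%:R : 'F_p)%R.
Proof. by move=> p_prime; apply: eq_card => q; rewrite !inE -!natrD Fp_eq_mod. Qed.

Lemma eq_energy (I : finType) (V : nmodType) (a b : I -> V) : a =1 b -> energy a = energy b.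
Proof. by move=> eq_ab; apply: eq_card => q; rewrite !inE !eq_ab. Qed.

Section GeometricEnergy.
Variables (F : finFieldType) (g : F) (N k : nat).
Hypotheses (g_prim : (#|F|.-1.-primitive_root g)%R) (N_small : N ^ 2 <= #|F|.-1).
Hypotheses (k_ge : 512 <= k) (N_ge : growth_constant * k ^ 22 <= N).

Lemma geometric_energy_le : k * energy (fun i : 'I_N => g ^+ i.+1)%R <= 4 * N ^ 3.
Proof.
have k_gt0 : 0 < k by apply: leq_trans k_ge.
have kN : k <= N := leq_trans (leq_mul_expS k 21 growth_constant_gt0) N_ge.
have N_gt0 : 0 < N := leq_trans k_gt0 kN.
have g_neq0 : (g != 0)%R by rewrite (prim_root_eq0 g_prim) -lt0n (prim_order_gt0 g_prim).
have a_neq0 i : (g ^+ i.+1 != 0)%R by rewrite expf_neq0.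
have a_inj : injective (fun i : 'I_N => g ^+ i.+1)%R.
  move=> i j; rewrite !exprS => /(mulfI g_neq0)/eqP; rewrite (eq_prim_root_expr g_prim).
  have small (i' : 'I_N) : i' < #|F|.-1.
    by rewrite (leq_trans (ltn_ord i')) // (leq_trans _ N_small) // leq_pmulr.
  by rewrite !modn_small // => /eqP/val_inj.
have div_aW (i j : 'I_N) : (g ^+ i.+1 / g ^+ j.+1)%R \in window g N 1.
  by apply: expg_div_window => //; rewrite mul1n; have := ltn_ord i; have := ltn_ord j; lia.
have line_le th : (th != 0)%R -> #|line_points (window g N 1) th| <= N %/ k.
  by move=> th_neq0; rewrite leq_divRL // card_line_points_le.
have W_le : #|window g N 1| <= 3 * N.
  by apply: leq_trans (card_window _ _ _) _; move: N_gt0; clear; lia.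
have kJ : k * (N %/ k) <= N by rewrite mulnC leq_trunc_div.
have := energy_le a_inj (fun i => a_neq0 i) div_aW line_le; rewrite card_ord => E_le.
apply: leq_trans (leq_mul (leqnn k) E_le) _.
have := leq_mul (leq_mul (leqnn N) W_le) kJ; have := leq_mul kN (leqnn (N ^ 2)).
by move: (N %/ k); clear; lia.
Qed.

End GeometricEnergy.

Section Growth.
Import Order.TTheory Num.Theory.
Variables (p g N : nat).
Hypotheses (p_prime : prime p) (g_root : primitive_root p g) (N_small : N ^ 2 < p).

Lemma avg_abs_sum_sqr_ge k : 512 <= k -> growth_constant * k ^ 22 <= N ->
  (k%:R <= 4 * avg_abs_sum p g N ^+ 2)%R.
Proof.
move=> k_ge N_ge; set A := avg_abs_sum p g N.
have k_gt0 : 0 < k by apply: leq_trans k_ge.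
have N_gt0 : 0 < N := leq_trans k_gt0 (leq_trans (leq_mul_expS k 21 growth_constant_gt0) N_ge).
have N3_gt0 : (0 < N%:R ^+ 3 :> R)%R by rewrite exprn_gt0 ?ltr0n.
have := avg_abs_sum_energy_ge g N (prime_gt0 p_prime); rewrite modular_energy_Fp // -/A.
rewrite (eq_energy (b := fun i : 'I_N => (g%:R : 'F_p) ^+ i.+1)%R) => [|i]; last exact: natrX.
set E := energy _; have : k * E <= 4 * N ^ 3.
  apply: geometric_energy_le => //; rewrite card_Fp //; first exact: primitive_root_Fp.
  by rewrite -ltnS prednK ?prime_gt0.
rewrite -(ler_nat R) natrM [leRHS]natrM natrX => kE_le A_ge.
rewrite -(ler_pM2r N3_gt0); apply: le_trans (ler_wpM2l (ler0n _ k) A_ge) _.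
by rewrite mulrCA [leRHS]mulrAC [leRHS]mulrC ler_wpM2l ?sqr_ge0.
Qed.

Lemma avg_abs_sum_pow_ge : growth_constant * 512 ^ 22 <= N ->
  (N%:R <= (growth_constant * 512 ^ 22)%:R * avg_abs_sum p g N ^+ 44)%R.
Proof.
move=> N_ge; pose P k := growth_constant * (512 * k) ^ 22 <= N.
have P_le k : P k -> k <= N.
  apply: leq_trans; apply: leq_trans (leq_mul_expS _ 21 growth_constant_gt0).
  by rewrite leq_pmull.
have [k Pk k_max] := ex_maxnP (ex_intro P 1 N_ge) P_le.
have k_gt0 : 0 < k by apply: k_max.
have N_lt : N <= growth_constant * (512 * (2 * k)) ^ 22.
  apply: ltnW; apply: (@leq_trans (growth_constant * (512 * k.+1) ^ 22)).
    by rewrite ltnNge; apply/negP=> /k_max; rewrite ltnn.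
  rewrite (leq_pmul2l growth_constant_gt0) leq_exp2r // leq_pmul2l //.
  by rewrite mul2n -addnn -addn1 leq_add2l.
have kA : ((2 * k)%:R <= avg_abs_sum p g N ^+ 2)%R.
  rewrite -(ler_pM2l (ltr0n R 4)) -natrM; apply: le_trans (avg_abs_sum_sqr_ge _ Pk).
    by rewrite ler_nat mulnA leq_mul2r orbT.
  exact: leq_pmulr.
apply: le_trans (_ : (growth_constant * 512 ^ 22)%:R * (2 * k)%:R ^+ 22 <= _)%R.
  by rewrite -natrX -natrM ler_nat -mulnA -expnMn.
by rewrite (exprM _ 2 22) ler_wpM2l ?ler0n // lerXn2r ?nnegrE ?ler0n ?sqr_ge0.
Qed.

End Growth.

Section RootBound.
Import Order.TTheory Num.Theory.

Lemma avg_abs_sum_ge0 p g N : (0 <= avg_abs_sum p g N)%R.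
Proof.
rewrite /avg_abs_sum sum0E !RealsE mulr_ge0 ?invr_ge0 ?ler0n // sumr_ge0 // => x _.
by rewrite /exp_sum_abs RsqrtE sqrtr_ge0.
Qed.

Lemma Rpower_inv_le (x y : R) n : Rlt 0 x -> (0 <= y)%R -> (x <= y ^+ n.+1)%R ->
  Rle (Rpower x (/ INR n.+1)) y.
Proof.
move=> x_gt0 y_ge0 x_le; apply/RleP; have r_ge0 : (0 <= Rpower x (/ INR n.+1))%R.
  by apply/RleP/Rlt_le/exp_pos.
rewrite -(ler_pXn2r (ltn0Sn n)) ?nnegrE // (le_trans _ x_le) //.
rewrite -RpowE -Rpower_pow ?Rpower_mult; last exact: exp_pos.
by rewrite Rinv_l ?Rpower_1 //; apply: not_0_INR.
Qed.

Lemma avg_abs_sum_growth : exists D : nat, Rlt 0 (INR D) /\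
  forall p g N : nat, Znumtheory.prime (Z.of_nat p) -> primitive_root p g ->
    le 1 N -> le D N -> Rlt (INR N) (sqrt (INR p)) ->
    Rle (Rpower (INR N) (Rinv (IZR 44))) (Rmult (INR D) (avg_abs_sum p g N)).
Proof.
have [D D_gt0 pow_ge] : exists2 D, 0 < D & forall p g N, prime p -> primitive_root p g ->
    N ^ 2 < p -> D <= N -> (N%:R <= D%:R * avg_abs_sum p g N ^+ 44)%R.
  exists (growth_constant * 512 ^ 22); last exact: avg_abs_sum_pow_ge.
  by rewrite muln_gt0 growth_constant_gt0 expn_gt0.
exists D; split; first exact/lt_0_INR/ssrnat.ltP.
move=> p g N /Zprime_prime p_prime g_root /ssrnat.leP N_gt0 /ssrnat.leP N_ge /RltP N_small.
have {}N_small : N ^ 2 < p.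
  rewrite RsqrtE !INRE in N_small; rewrite -(ltr_nat R) natrX -[ltRHS]sqr_sqrtr ?ler0n //.
  by rewrite ltr_pXn2r ?nnegrE ?ler0n ?sqrtr_ge0.
have A_ge0 := avg_abs_sum_ge0 p g N.
rewrite (_ : IZR 44 = INR 44); last by rewrite INR_IZR_INZ.
apply: Rpower_inv_le.
- by apply/RltP; rewrite INRE ltr0n.
- by rewrite RmultE mulr_ge0 // INRE ler0n.
apply: le_trans (_ : D%:R * avg_abs_sum p g N ^+ 44 <= _)%R; first by rewrite INRE pow_ge.
rewrite RmultE INRE [leRHS]exprMn.
by rewrite ler_wpM2r ?exprn_ge0 // -natrX ler_nat -[leqLHS]expn1 leq_pexp2l.
Qed.

End RootBound.

End GeometricSums.

Open Scope R_scope.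

Theorem theorem5 :
  forall eps : R, 0 < eps ->
  exists c : R, 0 < c /\
  exists N0 : nat,
  forall p g N : nat,
    prime (Z.of_nat p) ->
    primitive_root p g ->
    (1 <= N)%nat -> (N0 <= N)%nat ->
    INR N < sqrt (INR p) ->
    avg_abs_sum p g N >= c * Rpower (INR N) (1/48 - eps).
Proof.
move=> eps eps_gt0; have [D [D_gt0 growth]] := GeometricSums.avg_abs_sum_growth.
have invD_gt0 := Rinv_0_lt_compat _ D_gt0.
exists (/ INR D); split=> //; exists D => p g N p_prime g_root N_ge1 N_ge N_small.
have INR_N_ge1 : 1 <= INR N := le_INR 1 N N_ge1.
apply: Rle_ge; apply: (Rmult_le_reg_l (INR D)) => //.
rewrite -Rmult_assoc Rinv_r ?Rmult_1_l; last lra.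
apply: Rle_trans (growth p g N p_prime g_root N_ge1 N_ge N_small).
by apply: Rle_Rpower => //; lra.
Qed.
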